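(* Let $r\ge3$ be an odd integer and $a=r+1$. The subtraction game $\mathcal{S}(1,a,3a+r)$ is ultimately periodic with period $4a$ and nim-sequence $\big((01)^{a/2-1}\,2\big)^2\big((01)^{a/2}\,2\big)^2$. Moreover, if $r=3$ then the subtraction set is non-expandable; otherwise the subtraction set has expansion $\{1,a,4a-1\}\cup\{4a+1,5a\}^{*(4a)}$ (equivalently $\{1,a,3a+r\}\cup\{3a+r+2,4a+r+1\}^{*(4a)}$).
   Context: For a finite set $S$ of positive integers, the subtraction game $\mathcal{S}(S)$ is played on a single pile: two players alternately remove $s\in S$ coins (at most the pile size); the last mover wins. The nim-value is $\mathcal{G}(n)=\operatorname{mex}\{\mathcal{G}(n-s): s\in S, s\le n\}$. Words of single digits are written by juxtaposition, and $x^m$ denotes $m$-fold repetition of the block $x$. ''The game is ultimately periodic with period $p$ and nim-sequence $W$'' ($W$ a word of length $p$) means $p$ is the least positive integer with $\mathcal{G}(n+p)=\mathcal{G}(n)$ for all sufficiently large $n$, and there is $n_0\ge0$ such that $\mathcal{G}(n_0+j)$ is the $((j\bmod p)+1)$-st letter of $W$ for all $j\ge0$. The expansion of $S$ is $S^{ex}=\{s\ge1:\mathcal{G}(n+s)\ne\mathcal{G}(n)\ \forall n\ge0\}$; ''has expansion $T$'' means $S^{ex}=T$. For a set $X$ and $p\ge1$, $X^{*p}=\{x+mp:x\in X,m\ge0\}$. $S$ is non-expandable if $S^{ex}=S$ or $S^{ex}=S^{*p}$, $p$ the period. *)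

(* Defs.v *)
From HB Require Import structures.
From mathcomp Require Import all_boot finmap.
From mathcomp Require Import classical_sets.

Set Implicit Arguments.
Unset Strict Implicit.
Unset Printing Implicit Defensive.

Local Open Scope nat_scope.

Lemma mex_subproof (A : {fset nat}) : exists k, k \notin A.
Proof.
exists (\max_(i <- A) i).+1; apply/negP => kA.
by have := @leq_bigmax_seq _ (enum_fset A) xpredT id _ kA isT; rewrite ltnn.
Qed.

Definition mex (A : {fset nat}) : nat := ex_minn (mex_subproof A).

(* [:: G(0); ...; G(n - 1)], where G is the nim-value function of the
   subtraction game S(S).  The recurrence is [nim_valueE] below. *)
Fixpoint nim_values (S : {fset nat}) (n : nat) : seq nat :=
  if n is m.+1 then
    let h := nim_values S m in
    rcons h (mex [fset nth 0 h (m - s) | s in S & s <= m]%fset)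
  else [::].

Definition nim_value (S : {fset nat}) (n : nat) : nat :=
  nth 0 (nim_values S n.+1) n.

Lemma size_nim_values S n : size (nim_values S n) = n.
Proof. by elim: n => //= n IHn; rewrite size_rcons IHn. Qed.

Lemma nth_nim_values S n i : i < n -> nth 0 (nim_values S n) i = nim_value S i.
Proof.
elim: n => // n IHn; rewrite ltnS leq_eqVlt => /predU1P[->|lt_in] //=.
by rewrite nth_rcons size_nim_values lt_in IHn.
Qed.

Lemma nim_valueE (S : {fset nat}) (n : nat) : 0 \notin S ->
  nim_value S n = mex [fset nim_value S (n - s) | s in S & s <= n]%fset.
Proof.
move=> S0; rewrite {1}/nim_value /= nth_rcons size_nim_values ltnn eqxx.
congr mex; apply: eq_in_imfset => s /andP[sS le_sn].
have s_gt0 : 0 < s by rewrite lt0n; apply: contraNneq S0 => <-.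
by rewrite nth_nim_values // ltn_subrL s_gt0 (leq_trans s_gt0).
Qed.

Definition eventual_period (g : nat -> nat) (p : nat) : Prop :=
  0 < p /\ exists N, forall n, N <= n -> g (n + p) = g n.

Definition is_period (g : nat -> nat) (p : nat) : Prop :=
  eventual_period g p /\ forall q, eventual_period g q -> p <= q.

Definition ultimately_periodic_with
    (S : {fset nat}) (p : nat) (W : seq nat) : Prop :=
  [/\ size W = p, is_period (nim_value S) p
    & exists n0, forall j, nim_value S (n0 + j) = nth 0 W (j %% p)].

Definition word_exp (x : seq nat) (m : nat) : seq nat := flatten (nseq m x).

Definition expansion (S : {fset nat}) : set nat :=
  [set s | 1 <= s /\ forall n, nim_value S (n + s) <> nim_value S n]%classic.

Definition star (X : set nat) (p : nat) : set nat :=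
  [set y | exists x m, X x /\ y = x + m * p]%classic.

Definition non_expandable (S : {fset nat}) : Prop :=
  exists p, is_period (nim_value S) p /\
    (expansion S = [set` S]%classic \/ expansion S = star [set` S]%classic p).

(* Main.v *)
Require Import Defs.
From mathcomp Require Import all_boot finmap.
From mathcomp Require Import classical_sets.
From mathcomp Require Import boolp zify.

(* After a preperiod the nim-values follow a word of length 4a whose letters 2
   stand at 1, a, 2a + 1 and 3a + 2, with 0 and 1 alternating in between; the
   resulting explicit formula satisfies the mex recurrence, hence is the
   nim-value function.  A shift by less than 4a cannot preserve the set of
   positions of the letters 2, so 4a is the least period.  The word differs
   from its cyclic shift by s in every position only for s = 1, a, -a, -1
   modulo 4a.  The shifts -a, and -1 beyond 4a - 1, are excluded by coincidences
   at the start of the game, and if a = 4 those congruent to 1 and a beyond 1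
   and a are excluded by the exceptional value at 16. *)

Set Implicit Arguments.
Unset Strict Implicit.
Unset Printing Implicit Defensive.

Local Open Scope nat_scope.

(** * Uniqueness of solutions of the mex recurrence *)

Lemma mex_eq (A : {fset nat}) k :
  k \notin A -> (forall j, j < k -> j \in A) -> mex A = k.
Proof.
move=> kA ltA; rewrite /mex; case: ex_minnP => m mA min_m.
apply/eqP; rewrite eqn_leq min_m // leqNgt; apply/negP => /ltA.
by rewrite (negPf mA).
Qed.

(** The two hypotheses say that [g n] is the mex of the values of [g] at the options of [n]; since
    [0] is not a move, options are smaller and strong induction applies. *)
Lemma nim_value_unique (S : {fset nat}) (g : nat -> nat) : 0 \notin S ->
  (forall n s, s \in S -> s <= n -> g (n - s) <> g n) ->
  (forall n j, j < g n -> exists2 s, s \in S & s <= n /\ g (n - s) = j) ->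
  nim_value S =1 g.
Proof.
move=> S0 g_neq g_lt; elim/ltn_ind => n IHn; rewrite nim_valueE //.
have IHs s : s \in S -> s <= n -> nim_value S (n - s) = g (n - s).
  by move=> sS le_sn; apply: IHn; case: s sS le_sn S0 => [->|s]//; lia.
apply: mex_eq => [|j /g_lt[s sS [le_sn gj]]].
  apply/imfsetP => -[s /= /andP[sS le_sn]]; rewrite IHs //.
  by move/esym; apply: g_neq.
by apply/imfsetP; exists s; rewrite ?IHs //=; apply/andP.
Qed.

(** * The explicit formula and its coordinates *)

(* Position [x] of the period starting at a multiple of 4a. *)
Definition period_letter (a x : nat) : nat :=
  if (x == 1) || (x == a) || (x == 2 * a + 1) || (x == 3 * a + 2) then 2
  else if (1 < x < a) || (2 * a + 1 < x < 3 * a + 2) then odd x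
  else ~~ odd x.

(* For a = 4 the preperiod deviates from the general pattern. *)
Definition nimber (a n : nat) : nat :=
  if n < a then nat_of_bool (odd n)
  else if n == 4 * a - 1 then (if a == 4 then 3 else 2)
  else if n == 4 * a then (if a == 4 then 2 else 3)
  else if (a == 4) && ((n == 17) || (n == 20)) then 3
  else period_letter a (n %% (4 * a)).

(* Coordinates [t], [x] instead of quotient and remainder keep all later
   conditions linear, as [lia] requires. *)
Lemma period_coordinates a n : 4 <= a -> exists t x,
  [/\ n = t + x, 4 * a %| t, x < 4 * a & [\/ t = 0, t = 4 * a | 8 * a <= t]].
Proof.
move=> a4; exists (n %/ (4 * a) * (4 * a)), (n %% (4 * a)).
split; [exact: divn_eq | exact: dvdn_mull | by rewrite ltn_mod; lia |].
case: (n %/ (4 * a)) => [|[|m]]; first by constructor 1.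
  by constructor 2; lia.
by constructor 3; rewrite !mulSn; lia.
Qed.

Definition letter_at (a t x : nat) : nat :=
  if (t == 0) && (x < a) then nat_of_bool (odd x)
  else if (t == 0) && (x == 4 * a - 1) then (if a == 4 then 3 else 2)
  else if (t == 4 * a) && (x == 0) then (if a == 4 then 2 else 3)
  else if [&& a == 4, t == 16 & (x == 1) || (x == 4)] then 3
  else period_letter a x.

Lemma nimberE a t x : 4 <= a -> 4 * a %| t -> x < 4 * a ->
  nimber a (t + x) = letter_at a t x.
Proof.
move=> a4 /dvdnP[m ->] xa.
rewrite /nimber /letter_at modnMDl modn_small //.
case: m => [|[|m]].
- rewrite mul0n add0n /= andbF.
  have -> : (x == 4 * a) = false by lia.
  have -> : (a == 4) && ((x == 17) || (x == 20)) = false by lia.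
  by have -> : (0 == 4 * a) = false by lia.
- rewrite mul1n eqxx /=.
  have -> : (4 * a + x < a) = false by lia.
  have -> : (4 * a + x == 4 * a - 1) = false by lia.
  have -> : (4 * a == 0) = false by lia.
  have -> : (4 * a + x == 4 * a) = (x == 0) by lia.
  have -> // : (a == 4) && ((4 * a + x == 17) || (4 * a + x == 20)) =
    [&& a == 4, 4 * a == 16 & (x == 1) || (x == 4)] by lia.
- have : 8 * a <= m.+2 * (4 * a) by rewrite !mulSn; lia.
  move: (m.+2 * _) => u H.
  have -> : (u + x < a) = false by lia.
  have -> : (u + x == 4 * a - 1) = false by lia.
  have -> : (u + x == 4 * a) = false by lia.
  have -> : (a == 4) && ((u + x == 17) || (u + x == 20)) = false by lia.
  have -> : (u == 0) = false by lia.
  have -> : (u == 4 * a) = false by lia.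
  by have -> : [&& a == 4, u == 16 & (x == 1) || (x == 4)] = false by lia.
Qed.


(** * Verification of the mex recurrence *)

(** [None] encodes an illegal move. As moves are shorter than 4a, at most one period has to be
    borrowed from [t]. *)
Definition predecessor_letter (a t x s : nat) : option nat :=
  if s <= x then Some (letter_at a t (x - s))
  else if t == 0 then None else Some (letter_at a (t - 4 * a) (x + 4 * a - s)).

Lemma predecessor_letterE a t x s : 4 <= a -> 4 * a %| t -> x < 4 * a ->
    s < 4 * a ->
  predecessor_letter a t x s =
    if s <= t + x then Some (nimber a (t + x - s)) else None.
Proof.
move=> a4 dt xa sa; rewrite /predecessor_letter.
have [le_sx|lt_xs] := leqP s x.
  by rewrite -addnBA // nimberE ?leq_addl ?(leq_trans le_sx) //; lia.
have [->|t0] := eqVneq t 0; first by rewrite add0n leqNgt lt_xs.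
have ta : 4 * a <= t by apply: dvdn_leq => //; rewrite lt0n.
have -> : s <= t + x by lia.
have -> : t + x - s = t - 4 * a + (x + 4 * a - s) by lia.
by rewrite nimberE ?dvdn_subl //; lia.
Qed.

(** With three moves a mex is at most 3, so only 0, 1 and 2 can be required among the options; this
    makes the condition a closed boolean computation. *)
Definition is_mex3 (u v w : option nat) (k : nat) : bool :=
  [&& Some k != u, Some k != v, Some k != w &
   all (fun j => (j < k) ==> [|| Some j == u, Some j == v | Some j == w])
       [:: 0; 1; 2]] && (k <= 3).

Ltac decide_ifs :=
  repeat match goal with |- context [if ?c then _ else _] =>
    first [ have -> : c = false by lia | have -> : c = true by lia ]
  end.

(** Leaves [odd x] as the only undetermined parity, so that [case: (odd x)] can finish;
    [assert_fails] prevents looping on [odd x] itself. *)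
Ltac decide_parity x :=
  repeat match goal with |- context [odd ?y] =>
    first [ have -> : odd y = true by lia | have -> : odd y = false by lia
          | assert_fails (constr_eq y x);
            first [ have -> : odd y = odd x by lia
                  | have -> : odd y = ~~ odd x by lia ] ]
  end.

(* On each of these regions every letter, also one move away, is determined up
   to parity, so statements about letters can be computed region by region. *)
Lemma residue_regions a x : 4 <= a -> ~~ odd a -> x < 4 * a ->
  x = 0 \/ x = 1 \/ x = 2 \/ 2 < x < a - 1 \/ x = a - 1 \/ x = a \/
  x = a + 1 \/ x = a + 2 \/ a + 2 < x < 2 * a - 1 \/ x = 2 * a - 1 \/
  x = 2 * a \/ x = 2 * a + 1 \/ x = 2 * a + 2 \/
  2 * a + 2 < x < 3 * a - 1 \/ x = 3 * a - 1 \/ x = 3 * a \/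
  x = 3 * a + 1 \/ x = 3 * a + 2 \/ x = 3 * a + 3 \/
  3 * a + 3 < x < 4 * a - 2 \/ x = 4 * a - 2 \/ x = 4 * a - 1.
Proof. lia. Qed.

Lemma letter_mex a t x : 6 <= a -> ~~ odd a -> x < 4 * a ->
    [\/ t = 0, t = 4 * a | 8 * a <= t] ->
  is_mex3 (predecessor_letter a t x 1) (predecessor_letter a t x a)
    (predecessor_letter a t x (4 * a - 1)) (letter_at a t x).
Proof.
move=> a6 a_even xa t_val.
have a4 : 4 <= a by lia.
have x_val := residue_regions a4 a_even xa.
case: t_val => t_val; repeat destruct x_val as [x_val|x_val].
all: rewrite /predecessor_letter /letter_at /period_letter; decide_ifs.
all: decide_parity x.
all: by case: (odd x).
Qed.

(** The last exceptional position is 4a, or 20 = 5a if a = 4. *)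
Lemma nimber_periodic a n : 4 <= a -> 4 * a < n -> (a = 4 -> 5 * a < n) ->
  nimber a n = period_letter a (n %% (4 * a)).
Proof.
by move=> a4 n4 n5; rewrite /nimber; move: (n %% _) => m; decide_ifs.
Qed.

Definition nimber_before (a n s : nat) : option nat :=
  if s <= n then Some (nimber a (n - s)) else None.

Lemma nimber_mex a n : 4 <= a -> ~~ odd a ->
  is_mex3 (nimber_before a n 1) (nimber_before a n a)
    (nimber_before a n (4 * a - 1)) (nimber a n).
Proof.
move=> a4 a_even; have [a6|a_lt6] := leqP 6 a.
  have [t [x [-> dt xa t_val]]] := period_coordinates n a4.
  rewrite nimberE // /nimber_before -!predecessor_letterE ?letter_mex //; lia.
have ->: a = 4 by lia.
(* For a = 4 the last exceptional position is 20 and moves are at most 15. From 36 = 20 + 15 + 1 on,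
   a position and its options are thus all in the periodic range, and the bound 52 = 36 + 16 adds
   one full period. *)
have checked : all (fun n => is_mex3 (nimber_before 4 n 1)
  (nimber_before 4 n 4) (nimber_before 4 n 15) (nimber 4 n)) (iota 0 52).
  by vm_compute.
pose n' := if n < 52 then n else 36 + (n - 36) %% 16.
have n'_lt : n' < 52 by rewrite /n'; case: ifP => //; lia.
have := allP checked n'; rewrite mem_iota => /(_ n'_lt).
rewrite /n'; case: ifP => // n_ge; set k := 36 + _.
have k_mod : k = n %[mod 16] by rewrite /k; lia.
have shift s : s <= 15 -> nimber_before 4 n s = nimber_before 4 k s.
  move=> s15; rewrite /nimber_before.
  have -> : s <= n by lia.
  have -> : s <= k by rewrite /k; lia.
  by rewrite !nimber_periodic //; try (congr (Some (period_letter _ _))); lia.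
rewrite !shift // (_ : nimber 4 n = nimber 4 k) //.
by rewrite !nimber_periodic //; try (congr (period_letter _ _)); lia.
Qed.

Lemma nim_value_nimber a : 4 <= a -> ~~ odd a ->
  nim_value [fset 1; a; 4 * a - 1]%fset =1 nimber a.
Proof.
move=> a4 a_even; apply: nim_value_unique.
- by rewrite !inE; lia.
- move=> n s; rewrite !inE => sS le_sn.
  have := nimber_mex n a4 a_even.
  case/andP=> /and4P[n1 n2 n3 _] _ eq_n.
  have : nimber_before a n s == Some (nimber a n).
    by rewrite /nimber_before le_sn eq_n.
  by case/orP: sS => [/orP[]|] /eqP ->; rewrite eq_sym; apply/negP.
- move=> n j lt_j.
  have := nimber_mex n a4 a_even.
  case/andP=> /and4P[_ _ _ /allP n_all] n_le3.
  have /n_all : j \in [:: 0; 1; 2] by rewrite !inE; lia.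
  rewrite lt_j /nimber_before /=.
  case/or3P; case: ifP => // le_sn /eqP[->].
  + by exists 1; rewrite ?inE.
  + by exists a; rewrite ?inE ?eqxx ?orbT.
  + by exists (4 * a - 1); rewrite ?inE ?eqxx ?orbT.
Qed.

(** * Minimality of the period *)

Lemma period_letter_eq2 a x :
  (period_letter a x == 2) = (x \in [:: 1; a; 2 * a + 1; 3 * a + 2]).
Proof.
rewrite /period_letter !inE -!orbA; case: ifP => // _.
by case: ifP => _; case: (odd x).
Qed.

Lemma nimber_is_period a : 4 <= a -> ~~ odd a -> is_period (nimber a) (4 * a).
Proof.
move=> a4 a_even; split.
  split; first by lia.
  exists (5 * a).+1 => n n5.
  by rewrite !nimber_periodic ?modnDr //; lia.
move=> q [q0 [N perN]]; rewrite leqNgt; apply/negP => q_lt.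
have letter_q x : x < 4 * a ->
    (x \in [:: 1; a; 2 * a + 1; 3 * a + 2]) =
    ((x + q) %% (4 * a) \in [:: 1; a; 2 * a + 1; 3 * a + 2]).
  (* A multiple of 4a beyond both [N] and the preperiod. *)
  move=> xa; pose t := N.+2 * (4 * a).
  have t_ge : N + 8 * a <= t.
    by rewrite /t !mulSn; have := leq_pmulr N (n := 4 * a); lia.
  have t_mod y : (t + y) %% (4 * a) = y %% (4 * a) by rewrite modnMDl.
  have := perN (t + x) ltac:(lia).
  rewrite -addnA !nimber_periodic ?t_mod; try lia.
  by rewrite (modn_small xa) -!period_letter_eq2 => ->.
have mod_q x : x < 4 * a ->
    (x + q) %% (4 * a) = if x + q < 4 * a then x + q else x + q - 4 * a.
  move=> xa; case: ifP => [/modn_small //|q_ge].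
  rewrite -[x + q in LHS](@subnK (4 * a)); last by lia.
  by rewrite modnDr modn_small //; lia.
(* The shift sends the letter 2 at position 1 to one of the other three. *)
have q_val : q = a - 1 \/ q = 2 * a \/ q = 3 * a + 1.
  have := letter_q 1 ltac:(lia).
  by rewrite mod_q ?inE ?eqxx //=; [case: ifP => ? /esym /or4P[] /eqP; lia | lia].
(* Position a refutes a - 1 and 2a, being sent to 2a - 1 and 3a. Under 3a + 1 it goes to 1, so there
   position 2a + 1 is used, which goes to a + 2. *)
have := letter_q (2 * a + 1) ltac:(lia); have := letter_q a ltac:(lia).
rewrite !mod_q ?inE ?eqxx ?orbT //=; try lia.
by case: q_val => [|[]] ->; [move=> + _ | move=> + _ | move=> _];
  case: ifP => ? /esym /or4P[] /eqP; lia.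
Qed.

(** * The period as the stated word *)

Lemma nth_word_exp01 k i : i < 2 * k ->
  nth 0 (word_exp [:: 0; 1] k) i = odd i.
Proof.
elim: k i => [|k IHk] [|[|i]] //= lt_i.
by rewrite negbK IHk //; lia.
Qed.

Lemma size_word_exp x k : size (word_exp x k) = k * size x.
Proof. by elim: k => //= k IHk; rewrite size_cat IHk. Qed.

Definition nim_word (a : nat) : seq nat :=
  word_exp (word_exp [:: 0; 1] (a %/ 2 - 1) ++ [:: 2]) 2 ++
  word_exp (word_exp [:: 0; 1] (a %/ 2) ++ [:: 2]) 2.

Lemma nth_block k i : nth 0 (word_exp [:: 0; 1] k ++ [:: 2]) i =
  if i < 2 * k then nat_of_bool (odd i) else if i == 2 * k then 2 else 0.
Proof.
rewrite nth_cat size_word_exp /= [k * 2]mulnC.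
case: ltnP => [/nth_word_exp01 //|le_i].
case: eqP => [->|ne]; first by rewrite subnn.
by rewrite nth_default //=; lia.
Qed.

Lemma nth_word_exp2 (x y : seq nat) j :
  nth 0 (word_exp x 2 ++ word_exp y 2) j =
    if j < size x then nth 0 x j
    else if j < 2 * size x then nth 0 x (j - size x)
    else if j < 2 * size x + size y then nth 0 y (j - 2 * size x)
    else nth 0 y (j - 2 * size x - size y).
Proof.
rewrite /word_exp /= !cats0 -catA !nth_cat mul2n -addnn -!subnDA.
case: ltnP => // le_j; rewrite ltn_subLR //; case: ltnP => // le_2j.
by rewrite ltn_subLR.
Qed.

(** The word starts right after the letter 2 at residue 3a + 2; the first such start past the
    preperiod is 7a + 3. *)
Lemma nim_word_letter a j : 4 <= a -> ~~ odd a -> j < 4 * a ->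
  nth 0 (nim_word a) j =
  period_letter a ((7 * a + 3 + j) %% (4 * a)).
Proof.
move=> a4 a_even ja.
have [b def_a] : exists b, a = 2 * b by exists (a %/ 2); lia.
have -> : (7 * a + 3 + j) %% (4 * a) =
    if j + 3 < a then 3 * a + 3 + j else j + 3 - a.
  case: ifP => lt_j.
    rewrite (_ : 7 * a + 3 + j = 4 * a + (3 * a + 3 + j)); last by lia.
    by rewrite modnDl modn_small //; lia.
  rewrite (_ : 7 * a + 3 + j = 2 * (4 * a) + (j + 3 - a)); last by lia.
  by rewrite modnMDl modn_small //; lia.
rewrite /nim_word nth_word_exp2 !size_cat !size_word_exp /= !nth_block.
have -> : a %/ 2 = b by lia.
have j_val : j < a - 2 \/ j = a - 2 \/ a - 2 < j < 2 * a - 3 \/ j = 2 * a - 3 \/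
  2 * a - 3 < j < 3 * a - 2 \/ j = 3 * a - 2 \/ 3 * a - 2 < j < 4 * a - 1 \/
  j = 4 * a - 1 by lia.
rewrite /period_letter.
repeat destruct j_val as [j_val|j_val].
(* The residue wraps around to 0 inside the first block, at [j = a - 3]. *)
all: try (have [lt_j|ge_j] := ltnP (j + 3) a).
all: decide_ifs.
all: decide_parity j.
all: by case: (odd j).
Qed.

(** * Computation of the expansion *)

Lemma modn_small2 d x : x < 2 * d -> x %% d = if x < d then x else x - d.
Proof.
move=> x_lt; case: ifP => [/modn_small //|x_ge].
by rewrite -[x in LHS](@subnK d) ?modnDr ?modn_small //; lia.
Qed.

(** Serves shifts beyond 4a applied to positions below 4a: the start may be in the preperiod, the
    target is not. *)
Lemma letter_shift_neq a x : 6 <= a -> ~~ odd a -> x < 4 * a ->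
  period_letter a ((x + 1) %% (4 * a)) <> letter_at a 0 x /\
  period_letter a ((x + a) %% (4 * a)) <> letter_at a 0 x.
Proof.
move=> a6 a_even xa.
have a4 : 4 <= a by lia.
have x_val := residue_regions a4 a_even xa.
rewrite !modn_small2; try lia.
rewrite /letter_at /period_letter.
repeat destruct x_val as [x_val|x_val].
all: decide_ifs.
all: decide_parity x.
all: by case: (odd x).
Qed.

(** The excluded shifts are 1, a, -a and -1 modulo 4a. For any other shift one of the positions 0, a
    + 1 and 3a, with letters 1, 0 and 0, already gives a coincidence. *)
Lemma letter_repeat a x : 4 <= a -> ~~ odd a -> x < 4 * a ->
    x \notin [:: 1; a; 3 * a; 4 * a - 1] ->
  exists2 y, y < 4 * a & period_letter a ((x + y) %% (4 * a)) = period_letter a y.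
Proof.
move=> a4 a_even xa; rewrite !inE => x_not.
suff: [|| period_letter a ((x + 0) %% (4 * a)) == period_letter a 0,
  period_letter a ((x + (a + 1)) %% (4 * a)) == period_letter a (a + 1) |
  period_letter a ((x + 3 * a) %% (4 * a)) == period_letter a (3 * a)].
  by case/or3P=> /eqP eq_l; [exists 0|exists (a + 1)|exists (3 * a)]; try lia.
rewrite !modn_small2; try lia.
have x_val := residue_regions a4 a_even xa.
rewrite /period_letter.
repeat destruct x_val as [x_val|x_val].
all: try lia.
all: decide_ifs.
all: decide_parity x.
all: try by case: (odd x).
by rewrite !orbT.
Qed.

(** Here [n] is an option of [n + s], and a mex differs from the values of its options. *)
Lemma nimber_add_neq a n s : 4 <= a -> ~~ odd a ->
  s \in [:: 1; a; 4 * a - 1] -> nimber a (n + s) <> nimber a n.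
Proof.
move=> a4 a_even sS eq_n; have := nimber_mex (n + s) a4 a_even.
case/andP=> /and4P[n1 n2 n3 _] _.
suff : Some (nimber a (n + s)) != nimber_before a (n + s) s.
  by rewrite /nimber_before leq_addl addnK eq_n eqxx.
by move: sS n1 n2 n3; rewrite !inE => /or3P[] /eqP ->.
Qed.

Lemma nimber_add_late_neq a n s m : 6 <= a -> ~~ odd a ->
  s \in [:: 1; a] -> nimber a (n + (4 * a + s + m * (4 * a))) <> nimber a n.
Proof.
move=> a6 a_even sS; have a4 : 4 <= a by lia.
have s_gt0 : 0 < s by move: sS; rewrite !inE; lia.
rewrite nimber_periodic; try lia.
have -> : n + (4 * a + s + m * (4 * a)) = m.+1 * (4 * a) + (n + s).
  by rewrite mulSn; lia.
rewrite modnMDl; have [n_gt|n_le] := ltnP (4 * a) n.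
  (* Past 4a the multiples of the period drop out, leaving the move [s]. *)
  rewrite -nimber_periodic; try lia; apply: nimber_add_neq => //.
  by move: sS; rewrite !inE; case/orP=> ->; rewrite ?orbT.
have [n_lt|n_ge] := ltnP n (4 * a).
  have [neq1 neqa] := letter_shift_neq a6 a_even n_lt.
  rewrite -[n in nimber _ n]add0n nimberE ?dvdn0 //.
  by move: sS; rewrite !inE => /orP[] /eqP ->.
(* The value at 4a is 3, which is no letter of the period. *)
have -> : n = 4 * a by lia.
rewrite modnDl -[in X in _ <> X](addn0 (4 * a)) nimberE //; last by lia.
rewrite /letter_at /period_letter; move: (s %% _) => x; case: (odd x).
all: by decide_ifs; repeat case: ifP => _.
Qed.

Lemma nimber_expansion a s : 4 <= a -> ~~ odd a ->
  1 <= s /\ (forall n, nimber a (n + s) <> nimber a n) <->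
  s \in [:: 1; a; 4 * a - 1] \/
  a <> 4 /\ (exists m, s = 4 * a + 1 + m * (4 * a) \/ s = 5 * a + m * (4 * a)).
Proof.
move=> a4 a_even; split; last first.
  case=> [sS|[ne_a4 [m def_s]]].
    split; last by move=> n; apply: nimber_add_neq.
    by move: sS; rewrite !inE; lia.
  split; first by lia.
  move=> n; case: def_s => ->.
    by apply: nimber_add_late_neq; rewrite ?inE //; lia.
  rewrite (_ : 5 * a = 4 * a + a); last by lia.
  by apply: nimber_add_late_neq; rewrite ?inE ?eqxx ?orbT //; lia.
case=> s_gt0 s_neq.
have [t [x [def_s dt xa t_val]]] := period_coordinates s a4.
have t_mod y : (t + y) %% (4 * a) = y %% (4 * a).
  by case/dvdnP: dt => m ->; rewrite modnMDl.
have late y : 8 * a <= y -> nimber a y = period_letter a (y %% (4 * a)).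
  by move=> y_ge; rewrite nimber_periodic //; lia.
have [x_in|x_notin] := boolP (x \in [:: 1; a; 3 * a; 4 * a - 1]); last first.
  (* The coincidence is moved two periods on, clear of the preperiod. *)
  have [y ya eq_y] := letter_repeat a4 a_even xa x_notin.
  case: (s_neq (2 * (4 * a) + y)).
  rewrite !late; try lia.
  have -> : 2 * (4 * a) + y + s = 2 * (4 * a) + (t + (x + y)) by lia.
  by rewrite !modnMDl t_mod eq_y modn_small.
have t_pos : t = 0 \/ exists m, t = m.+1 * (4 * a).
  by case/dvdnP: dt => -[|m] ->; [left | right; exists m].
have small0 : nimber a 0 = 0 by rewrite /nimber; decide_ifs.
have small1 : nimber a 1 = 1 by rewrite /nimber; decide_ifs.
have x_val : x = 1 \/ x = a \/ x = 3 * a \/ x = 4 * a - 1.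
  by move: x_in; rewrite !inE; lia.
case: x_val => [x_1|[x_a|[x_3a|x_4a]]].
- case: t_pos => [t0|[m def_t]]; first by left; rewrite !inE; lia.
  right; split; last by exists m; left; rewrite def_s def_t x_1 mulSn; lia.
  (* If a = 4, position 16 has the exceptional value 2, which is also the letter at residues 1 and
     a; hence the same position excludes both kinds of late shift. *)
  move=> a_4; case: (s_neq 16); rewrite late; last by rewrite mulSn in def_t; lia.
  have -> : 16 + s = 1 * (4 * a) + (t + 1) by lia.
  by rewrite modnMDl t_mod a_4.
- case: t_pos => [t0|[m def_t]]; first by left; rewrite !inE; lia.
  right; split; last by exists m; right; rewrite def_s def_t x_a mulSn; lia.
  move=> a_4; case: (s_neq 16); rewrite late; last by rewrite mulSn in def_t; lia.
  have -> : 16 + s = 1 * (4 * a) + (t + 4) by lia.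
  by rewrite modnMDl t_mod a_4.
(* Every position of residue 3a, even in the preperiod, has the value 0 of the empty pile. *)
- case: (s_neq 0); rewrite add0n def_s small0 nimberE // x_3a.
  have a3_odd : odd (3 * a) = false by lia.
  by rewrite /letter_at /period_letter a3_odd; decide_ifs.
- case: t_pos => [t0|[m def_t]]; first by left; rewrite !inE; lia.
  (* Here [1 + s] is a multiple of 4a and at least 8a, so it has the letter 1 of residue 0, which is
     also the value at 1. *)
  case: (s_neq 1); rewrite late; last by rewrite mulSn in def_t; lia.
  have -> : 1 + s = 1 * (4 * a) + (t + 0) by lia.
  by rewrite modnMDl t_mod small1 mod0n /period_letter; decide_ifs.
Qed.

Theorem theorem3p16 (r a : nat) (hr : 3 <= r) (hodd : odd r) (ha : a = r + 1) :
  let S := [fset 1; a; (3 * a + r)%N]%fset in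
  [/\ ultimately_periodic_with S (4 * a)
        (word_exp (word_exp [:: 0; 1] (a %/ 2 - 1) ++ [:: 2]) 2 ++
         word_exp (word_exp [:: 0; 1] (a %/ 2) ++ [:: 2]) 2),
      r = 3 -> non_expandable S
    & r <> 3 ->
        expansion S =
          ([set 1; a; 4 * a - 1] `|`
           star [set 4 * a + 1; 5 * a] (4 * a))%classic /\
        expansion S =
          ([set 1; a; 3 * a + r] `|`
           star [set 3 * a + r + 2; 4 * a + r + 1] (4 * a))%classic].
Proof.
move=> S; have a4 : 4 <= a by lia.
have a_even : ~~ odd a by lia.
have def_r : 3 * a + r = 4 * a - 1 by lia.
have nimS : nim_value S = nimber a.
  by apply/funext => n; rewrite /S def_r; apply: nim_value_nimber.
have expS s : expansion S s <-> s \in [:: 1; a; 4 * a - 1] \/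
    a <> 4 /\ (exists m, s = 4 * a + 1 + m * (4 * a) \/ s = 5 * a + m * (4 * a)).
  by rewrite -nimber_expansion // -nimS.
split.
- split.
  + rewrite size_cat !size_word_exp !size_cat !size_word_exp /=; lia.
  + by rewrite nimS; apply: nimber_is_period.
  + exists (7 * a + 3) => j; rewrite nimS nimber_periodic; try lia.
    rewrite -/(nim_word a) nim_word_letter ?ltn_mod; try lia.
    by rewrite modnDmr.
- move=> r3; exists (4 * a); split; first by rewrite nimS; apply: nimber_is_period.
  left; apply/seteqP; split=> s /=.
    by move/expS => [|[]]; [rewrite !inE; lia | lia].
  by rewrite !inE => sS; apply/expS; left; rewrite !inE; lia.
- move=> r3; rewrite (_ : 3 * a + r + 2 = 4 * a + 1); last by lia.
  rewrite (_ : 4 * a + r + 1 = 5 * a); last by lia.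
  rewrite def_r; suff: expansion S = ([set 1; a; 4 * a - 1] `|`
           star [set 4 * a + 1; 5 * a] (4 * a))%classic by split.
  apply/seteqP; split=> s /=.
    move/expS => [|[_ [m [->|->]]]].
    + by rewrite !inE => /or3P[] /eqP ->; left; [left; left|left; right|right].
    + by right; exists (4 * a + 1), m; split=> //; left.
    + by right; exists (5 * a), m; split=> //; right.
  move=> sT; apply/expS; case: sT => [[[]|]|[y [m [[]]]]] => [->|->|->|-> ->|-> ->].
  + by left; rewrite !inE eqxx.
  + by left; rewrite !inE eqxx orbT.
  + by left; rewrite !inE eqxx !orbT.
  + by right; split; [lia | exists m; left].
  + by right; split; [lia | exists m; right].
Qed.
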